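(* Let $D$ be a dataset, let $\Omega=\{\omega_1,\dots,\omega_k\}$ be a finite set of outcomes, let $q$ be a real-valued quality function with sensitivity $\Delta>0$, and let $\varepsilon>0$. Write $q_i=q(D,\omega_i)$ and $q_*=\max_i q_i$. Then the Permute-and-Flip mechanism and Report Noisy Max with Exponential Noise (both defined below, run on the same inputs $D,q,\Delta,\Omega,\varepsilon$) have the same output distribution on $\{1,\dots,k\}$; that is, for every $i\in\{1,\dots,k\}$ the probability that Permute-and-Flip returns $i$ equals the probability that Report Noisy Max with Exponential Noise returns $i$.
   Context: $\mathrm{Expo}(\lambda)$ denotes the exponential distribution with rate $\lambda>0$, with density $f(x;\lambda)=\lambda e^{-\lambda x}\mathbf{1}[x\ge 0]$. $\mathrm{Bernoulli}(p)$ is a coin that equals $1$ with probability $p$. The sensitivity of $q$ is $\Delta=\sup_{D_1,D_2}\max_{\omega_i}|q(D_1,\omega_i)-q(D_2,\omega_i)|$ over neighboring datasets (differing by addition/removal of one person's data). Report Noisy Max with Exponential Noise: for each $i=1,\dots,k$ independently set $v_i=q(D,\omega_i)+X_i$ with $X_i\sim\mathrm{Expo}(\varepsilon/(2\Delta))$; return $\arg\max_i v_i$ (ties occur with probability zero). Permute-and-Flip: compute $q_*=\max_i q(D,\omega_i)$; draw a uniformly random permutation $\pi$ of $\{1,\dots,k\}$; for $j=1,\dots,k$ in order, let $r=\pi(j)$, $p=\exp\left(\frac{\varepsilon}{2\Delta}(q(D,\omega_r)-q_* )\right)$, and flip an independent $\mathrm{Bernoulli}(p)$ coin; if it equals $1$,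 return $r$ and stop. (The coin for an index attaining $q_*$ has $p=1$, so the procedure always returns.) *)

(* Defs.v *)
From HB Require Import structures.
From mathcomp Require Import all_boot all_order all_algebra all_fingroup.
From mathcomp Require Import all_classical all_reals all_analysis.
From mathcomp Require Import exponential_distribution.
Set Implicit Arguments. Unset Strict Implicit. Unset Printing Implicit Defensive.
Import Order.TTheory GRing.Theory Num.Theory.
Local Open Scope classical_set_scope.
Local Open Scope ring_scope.

Definition is_sensitivity {R : realType} {Data : Type} {k : nat}
  (nb : Data -> Data -> Prop) (q : Data -> 'I_k -> R) (Delta : R) : Prop :=
  (forall D1 D2 w, nb D1 D2 -> `|q D1 w - q D2 w| <= Delta) /\
  (forall b, (forall D1 D2 w, nb D1 D2 -> `|q D1 w - q D2 w| <= b) -> Delta <= b).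

(* q_* = max_j qv j (seeded with one of the values, so it is the true max). *)
Definition qmax {R : realType} {k : nat} (qv : 'I_k -> R) (i0 : 'I_k) : R :=
  \big[Num.max/qv i0]_(j : 'I_k) qv j.

Definition pf_coin {R : realType} {k : nat} (eps Delta : R) (qv : 'I_k -> R)
  (i0 : 'I_k) (r : 'I_k) : R :=
  expR (eps / (2 * Delta) * (qv r - qmax qv i0)).

(* Output distribution of Permute-and-Flip: the permutation s is uniform on
   the k! permutations; s j is the index examined at step j; index i is returned
   iff the coins of all indices s j examined before it (j < s^-1 i) come up 0
   and the coin of i comes up 1 (coins independent). *)
Definition PF_prob {R : realType} {k : nat} (eps Delta : R) (qv : 'I_k -> R)
  (i : 'I_k) : R :=
  \sum_(s : {perm 'I_k})
     (k`!%:R)^-1 *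
     ((\prod_(j : 'I_k | (j < (s^-1)%g i)%N) (1 - pf_coin eps Delta qv i (s j)))
      * pf_coin eps Delta qv i i).

Definition has_expo_law {d} {T : measurableType d} {R : realType}
  (P : probability T R) (rate : R) (X : T -> R) : Prop :=
  forall A : set R, measurable A ->
    P (X @^-1` A) = exponential_prob rate A.

Definition mutually_independent {d} {T : measurableType d} {R : realType}
  {k : nat} (P : probability T R) (X : 'I_k -> T -> R) : Prop :=
  forall A : 'I_k -> set R, (forall i, measurable (A i)) ->
    P (\bigcap_(i in [set: 'I_k]) (X i @^-1` A i)) =
    (\prod_(i < k) P (X i @^-1` A i))%E.

(* Event "Report Noisy Max returns i": v_i = q_i + X_i strictly exceeds every
   other v_j (ties have probability zero). *)
Definition RNM_event {T : Type} {R : realType} {k : nat}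
  (qv : 'I_k -> R) (X : 'I_k -> T -> R) (i : 'I_k) : set T :=
  [set w | forall j : 'I_k, j != i -> qv j + X j w < qv i + X i w].

(* Main.v *)
(** Put [lam = eps / (2 Delta)], let [p j] be the coin of index [j], and let
    [Z j = exp (- lam X_j)], which is uniform on [0, 1].  Report Noisy Max
    returns [i] iff [Z j / p j > Z i / p i] for all [j != i], so conditioning
    on [t = Z i / p i] gives the probability
    [p i * \int_0^1 \prod_(j != i) (1 - t p j) dt].
    Conditioning is made elementary: [F t = P (i wins, Z i < t p i)] has
    increments over [a, b] between [(b - a) p i g b] and [(b - a) p i g a] with
    [g t = \prod_(j != i) (1 - t p j)], and this determines [F 1 - F 0].
    On the other side, expanding the product [\prod (1 - p j)] over the indices
    preceding [i] into subsets [J], the set [J] precedes [i] in a random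
    permutation with probability [1 / (#|J| + 1) = \int_0^1 t ^ #|J| dt], which
    produces the same integral. *)

Require Import Defs.
From HB Require Import structures.
From mathcomp Require Import all_boot all_order all_algebra all_fingroup.
From mathcomp Require Import all_classical all_reals all_analysis.
From mathcomp Require Import measurable_realfun exponential_distribution.
From mathcomp Require Import polyrcf ring lra.
Set Implicit Arguments. Unset Strict Implicit. Unset Printing Implicit Defensive.
Import Order.TTheory GRing.Theory Num.Theory.
Local Open Scope ring_scope.

(** * Random permutations and the polynomial [prod_primitive] *)

(* Composing with a transposition shows that each element of [i |: J] is
   equally often the last of them. *)
Lemma card_perm_after_set (k : nat) (i : 'I_k) (J : {set 'I_k}) :
  i \notin J ->
  (#|[set s : {perm 'I_k} | [forall r in J, s r < s i]]| * #|J|.+1 = k`!)%N.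
Proof.
move=> iJ.
pose last (s : {perm 'I_k}) := [arg max_(u > i in i |: J) (s u : nat)].
have lastE s u : u \in i |: J ->
    (last s == u) = [forall r in i |: J, (s r <= s u)%N].
  move=> uK; rewrite /last; case: arg_maxnP => [|v vK vmax]; first exact: setU11.
  apply/eqP/forall_inP => [<- r /vmax //|umax].
  by apply/(@perm_inj _ s)/val_inj/anti_leq; rewrite umax //; apply: vmax.
have eq_card_last u : u \in i |: J ->
    #|[set s | last s == u]| = #|[set s | last s == i]|.
  move=> uK; rewrite -(card_imset _ (mulgI (tperm i u))).
  apply: eq_card => s; apply/imsetP/idP => [[t + ->]|]; rewrite !inE.
    rewrite !lastE ?setU11 // => /forall_inP tu; apply/forall_inP => r rK.
    rewrite !permM tpermL; apply: tu; rewrite /=.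
    by case: tpermP => // _; rewrite ?setU11.
  rewrite lastE ?setU11 // => /forall_inP si.
  exists (tperm i u * s)%g; last by rewrite mulgA tperm2 mul1g.
  rewrite inE lastE //; apply/forall_inP => r rK.
  rewrite !permM tpermR; apply: si; rewrite /=.
  by case: tpermP => // _; rewrite ?setU11.
have -> : [set s : {perm 'I_k} | [forall r in J, s r < s i]]%N
    = [set s | last s == i].
  apply/setP => s; rewrite !inE lastE ?setU11 //.
  apply/forall_inP/forall_inP => [si r|si r rJ].
    by rewrite !inE => /orP[/eqP->|/si/ltnW].
  rewrite ltn_neqAle si ?andbT; last by rewrite !inE rJ orbT.
  apply: contra iJ => /eqP/val_inj/perm_inj <- //.
have <- : #|i |: J| = #|J|.+1 by rewrite cardsU1 iJ.
(* The fibres of [last] split the [k!] permutations into [#|J| + 1] classes of equal size. *)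
rewrite -[in RHS](card_Sn k) -[in RHS]sum1_card mulnC -sum_nat_const.
rewrite (partition_big last (mem (i |: J))) /=; last first.
  by move=> s _; rewrite /last; case: arg_maxnP => //; exact: setU11.
apply: eq_bigr => u uK; rewrite -(eq_card_last u) // sum1dep_card.
by apply: eq_card => s; rewrite !inE.
Qed.

Lemma prod1D_subset (R : comNzRingType) (I : finType) (P : {pred I})
    (x : I -> R) :
  \prod_(j | P j) (1 + x j)
  = \sum_(J : {set I} | J \subset P) \prod_(j in J) x j.
Proof.
rewrite big_mkcond /=.
(* Factors outside [P] become [0 + 1], so subsets not contained in [P] contribute [0]. *)
rewrite (eq_bigr (fun j => (if P j then x j else 0) + 1)); last first.
  by move=> j _; case: (P j); rewrite ?add0r // addrC.
rewrite bigA_distr [RHS]big_mkcond; apply: eq_bigr => J _ /=.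
rewrite -big_mkcond /=.
case: ifPn => [/fintype.subsetP JP|/fintype.subsetPn [j jJ jP]].
  by apply: eq_bigr => j /JP; rewrite unfold_in => ->.
rewrite (bigD1 j) //=; move: jP; rewrite unfold_in => /negbTE ->.
by rewrite mul0r.
Qed.

(* The antiderivative of [t |-> \prod_(j | j != i) (1 - t * p j)], expanded
   over the subsets of indices contributing a factor [- t * p j]. *)
Definition prod_primitive (R : fieldType) (k : nat) (p : 'I_k -> R) (i : 'I_k)
    : {poly R} :=
  \sum_(J : {set 'I_k} | i \notin J)
    ((\prod_(j in J) - p j) / #|J|.+1%:R) *: 'X^(#|J|.+1).

Lemma subset_predC1 (T : finType) (i : T) (J : {set T}) :
  (J \subset [pred j | j != i]) = (i \notin J).
Proof.
apply/fintype.subsetP/idP => [H|iJ j jJ].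
  by apply/negP => /H; rewrite inE eqxx.
by rewrite inE; apply: contraNneq iJ => <-.
Qed.

Lemma deriv_prod_primitive (R : numFieldType) (k : nat) (p : 'I_k -> R)
    (i : 'I_k) (t : R) :
  (prod_primitive p i)^`().[t] = \prod_(j | j != i) (1 - t * p j).
Proof.
rewrite (prod1D_subset [pred j | j != i] (fun j => - (t * p j))).
rewrite raddf_sum /= horner_sum; apply: eq_big => J.
  by rewrite subset_predC1.
move=> _; rewrite derivZ derivXn hornerZ hornerMn hornerXn.
rewrite mulrnAr -mulrnAl -[_ / _ *+ _]mulr_natr divfK ?pnatr_eq0 //=.
rewrite mulrC -prodr_const -big_split /=.
by apply: eq_bigr => j _; rewrite mulrN.
Qed.

Lemma sum_perm_prod_before (R : numFieldType) (k : nat) (p : 'I_k -> R)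
    (i : 'I_k) :
  \sum_(s : {perm 'I_k})
     (k`!%:R)^-1 * \prod_(j : 'I_k | (j < (s^-1)%g i)%N) (1 - p (s j))
  = (prod_primitive p i).[1].
Proof.
(* After inversion [s r] is the position of [r], so the product will range over the [r] with
   [s r < s i]. *)
rewrite (reindex_inj (@invg_inj _)) /= -big_distrr /=.
transitivity ((k`!%:R)^-1 * \sum_(s : {perm 'I_k}) \sum_(J : {set 'I_k}
    | [forall r in J, s r < s i]%N) \prod_(j in J) - p j).
  congr (_ * _); apply: eq_bigr => s _.
  rewrite (reindex_inj (@perm_inj _ s)) /= invgK.
  under eq_bigr do rewrite permK.
  rewrite (prod1D_subset [pred j | s j < s i]%N (fun j => - p j)).
  by apply: eq_bigl => J; apply/fintype.subsetP/forall_inP.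
rewrite (exchange_big_dep (fun J : {set 'I_k} => i \notin J)) /=; last first.
  move=> s J _ /forall_inP si; apply/negP => /si; by rewrite ltnn.
rewrite mulr_sumr horner_sum; apply: eq_bigr => J iJ.
rewrite hornerZ hornerXn expr1n mulr1 sumr_const.
pose c := #|[set s : {perm 'I_k} | [forall r in J, s r < s i]%N]|.
rewrite (_ : #|_| = c); last by apply: eq_card => s; rewrite inE.
rewrite -(card_perm_after_set iJ) -/c natrM -[_ *+ c]mulr_natl.
have c0 : c%:R != 0 :> R.
  rewrite pnatr_eq0; apply/eqP => c0; have := card_perm_after_set iJ.
  by rewrite -/c c0 mul0n => /esym/eqP; rewrite eqn0Ngt fact_gt0.
have n0 : #|J|.+1%:R != 0 :> R by rewrite pnatr_eq0.
by move: (#|J|.+1%:R : R) n0 => n n0; field; rewrite c0 n0.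
Qed.

(** * Comparing functions through bounds on their increments *)

(** This replaces an integral of [g]: [F] will be a probability and [G] a polynomial, both with
    slopes controlled by [g]. *)
Lemma eq_increment (R : realType) (g F G : R -> R) :
  (forall a b, 0 <= a -> a <= b -> b <= 1 ->
     (b - a) * g b <= F b - F a <= (b - a) * g a) ->
  (forall a b, 0 <= a -> a <= b -> b <= 1 ->
     (b - a) * g b <= G b - G a <= (b - a) * g a) ->
  F 1 - F 0 = G 1 - G 0.
Proof.
move=> HF HG.
(* On the uniform grid the errors telescope, since the two bounds on an
   increment differ by a multiple of [g a - g b]. *)
have step N n : (n <= N.+1)%N ->
    `|(F (n%:R / N.+1%:R) - F 0) - (G (n%:R / N.+1%:R) - G 0)|
    <= (g 0 - g (n%:R / N.+1%:R)) / N.+1%:R.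
  elim: n => [_|n IH nN]; first by rewrite mul0r !subrr normr0 mul0r.
  have {IH} := IH (ltnW nN).
  set a := n%:R / N.+1%:R; set b := n.+1%:R / N.+1%:R.
  have ba : b - a = N.+1%:R^-1.
    by rewrite /a /b -mulrBl -natrB // subSnn mul1r.
  have i0 : 0 <= N.+1%:R^-1 :> R by rewrite invr_ge0 ler0n.
  have a0 : 0 <= a by rewrite divr_ge0 ?ler0n.
  have ab : a <= b by rewrite -subr_ge0 ba.
  have b1 : b <= 1 by rewrite ler_pdivrMr ?ltr0n // mul1r ler_nat.
  have := HF _ _ a0 ab b1; have := HG _ _ a0 ab b1; rewrite ba !ler_norml.
  move: (N.+1%:R^-1) => h; lra.
have {}step N : `|(F 1 - F 0) - (G 1 - G 0)| * N.+1%:R <= g 0 - g 1.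
  have := step N N.+1 (leqnn _); rewrite divff ?pnatr_eq0 //.
  by rewrite ler_pdivlMr ?ltr0n.
apply/eqP; rewrite -subr_eq0 -normr_le0 leNgt; apply/negP => d0.
set d := `|_| in d0 step.
(* This choice of [N] makes [N.+1] exceed [(g 0 - g 1) / d], contradicting [step]. *)
have := step (Num.truncn ((g 0 - g 1) / d)).
rewrite leNgt => /negP; apply.
by rewrite mulrC -ltr_pdivrMr // truncnS_gt.
Qed.

Local Open Scope classical_set_scope.
Local Open Scope ring_scope.

Lemma prod1B_le (R : realType) (k : nat) (p : 'I_k -> R) (i : 'I_k) (a b : R) :
  (forall j, 0 <= p j <= 1) -> a <= b -> b <= 1 ->
  \prod_(j | j != i) (1 - b * p j) <= \prod_(j | j != i) (1 - a * p j).
Proof.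
move=> p01 ab b1; apply: ler_prod => j _; have /andP[p0 p1] := p01 j.
by apply/andP; split; nra.
Qed.

(** By the mean value theorem the slope is the product at an intermediate point, and [prod1B_le]
    compares it with the endpoints. *)
Lemma prod_primitive_increment (R : realType) (k : nat) (p : 'I_k -> R)
    (i : 'I_k) (a b : R) :
  (forall j, 0 <= p j <= 1) -> a <= b -> b <= 1 ->
  (b - a) * \prod_(j | j != i) (1 - b * p j)
    <= (prod_primitive p i).[b] - (prod_primitive p i).[a]
    <= (b - a) * \prod_(j | j != i) (1 - a * p j).
Proof.
move=> p01; rewrite le_eqVlt => /predU1P[-> _|ab b1].
  by rewrite !subrr !mul0r lexx.
have [c] := poly_mvt (prod_primitive p i) ab.
rewrite in_itv /= => /andP[ac cb] ->.
rewrite deriv_prod_primitive [_ * (b - a)]mulrC.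
have c1 : c <= 1 by rewrite (le_trans (ltW cb)).
by rewrite !ler_pM2l ?subr_gt0 // !prod1B_le // ltW.
Qed.

(** * From exponential to uniform variables *)

(** For [0 < z] the event says that [X] exceeds [y = - ln z / rate], which has probability
    [exp (- rate * y) = z]. *)
Lemma expo_law_uniform (d : measure_display) (T : measurableType d)
    (R : realType) (P : probability T R) (rate : R) (X : {RV P >-> R}) (z : R) :
  0 < rate -> has_expo_law P rate X -> 0 <= z <= 1 ->
  P [set w | expR (- (rate * X w)) < z] = z%:E.
Proof.
move=> rate0 hX /andP[z0 z1].
move: z0; rewrite le_eqVlt => /predU1P[<-|z0].
  rewrite (_ : [set _ | _] = set0) ?measure0 //.
  by apply/seteqP; split=> // w /=; rewrite ltNge expR_ge0.
pose y := - ln z / rate.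
have y0 : 0 <= y by rewrite divr_ge0 ?(ltW rate0) // oppr_ge0 ln_le0.
have yz : expR (- rate * y) = z.
  by rewrite /y mulNr mulrC divfK ?gt_eqF // opprK lnK.
(* The complement splits into the negative half-line, of mass zero, and [[0, y]], whose mass has a
   closed form. *)
have -> : [set w | expR (- (rate * X w)) < z]
    = ~` (X @^-1` (`]-oo, 0[ `|` `[0, y])).
  apply/seteqP; split=> w /=;
    rewrite !in_itv /= -yz ltr_expR mulNr ltrN2 ltr_pM2l //.
    move=> yX [|/andP[_]]; apply/negP; rewrite -?leNgt -?ltNge //.
    by rewrite ltW // (le_lt_trans y0).
  move=> H; rewrite ltNge; apply/negP => Xy; apply: H.
  by case: (ltP (X w) 0) => X0; [left|right; rewrite Xy].
have mI : measurable (`]-oo, (0:R)[%classic `|` `[0, y]%classic).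
  by apply: measurableU; exact: measurable_itv.
rewrite probability_setC; last exact: measurable_funPTI.
have -> : P (X @^-1` (`]-oo, 0[ `|` `[0, y]))
    = (exponential_prob rate `]-oo, 0%R[ + exponential_prob rate `[0%R, y])%E.
  rewrite -!hX //; rewrite preimage_setU measureU //.
  - exact: measurable_funPTI.
  - exact: measurable_funPTI.
  - apply/seteqP; split=> // w [] /=; rewrite !in_itv /= => H /andP[].
    by rewrite leNgt H.
have -> : exponential_prob rate `]-oo, (0:R)[ = 0%E.
  rewrite /exponential_prob integral0_eq // => x /=; rewrite in_itv /= => x0.
  by rewrite lt0_exponential_pdf.
rewrite add0e.
have -> : exponential_prob rate `[0, y] = (1 - z%:E)%E.
  (* If [y = 0], that is [z = 1], the interval is a single point and has mass zero. *)
  move: y0; rewrite le_eqVlt => /predU1P[y0|y0].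
    by rewrite /exponential_prob -yz -y0 mulr0 expR0 set_itv1 integral_set1 subee.
  by rewrite exponential_prob_itv0c // yz.
by transitivity ((1 - (1 - z))%:E) => //; congr EFin; ring.
Qed.

Lemma probability_setD (d : measure_display) (T : measurableType d)
    (R : realType) (P : probability T R) (A B : set T) :
  measurable A -> measurable B -> B `<=` A -> P (A `\` B) = (P A - P B)%E.
Proof.
move=> mA mB BA; rewrite measureD ?(setIidr BA) //.
by rewrite (le_lt_trans (probability_le1 _ _)) ?ltry.
Qed.

(** * The race between rescaled uniform variables *)

Section uniform_race.
Context (d : measure_display) (T : measurableType d) (R : realType).
Variables (P : probability T R) (k : nat) (Z : 'I_k -> T -> R).
Variables (p : 'I_k -> R) (i : 'I_k).
Hypothesis mZ : forall j, measurable_fun setT (Z j).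
Hypothesis Zind : mutually_independent P Z.
Hypothesis Zunif :
  forall j (z : R), 0 <= z <= 1 -> P [set w | Z j w < z] = z%:E.
Hypothesis p01 : forall j, 0 < p j <= 1.

(** The box puts [Z i / p i] in [[a, b[] and every other [Z j / p j] at or above [c]; it will
    bracket the winning event from inside with [c = b] and from outside with [c = a]. *)
Let box (a b c : R) (j : 'I_k) : set R :=
  if j == i then `[a * p i, b * p i[%classic else `[c * p j, +oo[%classic.

Let mZpre j (A : set R) : measurable A -> measurable (Z j @^-1` A).
Proof. by move=> mA; rewrite -[X in measurable X]setTI; exact: mZ. Qed.

Let mZlt j z : measurable [set w | Z j w < z].
Proof.
rewrite (_ : [set _ | _] = Z j @^-1` `]-oo, z[); last first.
  by apply/seteqP; split=> w /=; rewrite in_itv.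
by apply: mZpre; exact: measurable_itv.
Qed.

Let prob_box a b c : 0 <= a -> a <= b -> b <= 1 -> 0 <= c -> c <= 1 ->
  P (\bigcap_(j in [set: 'I_k]) (Z j @^-1` box a b c j))
  = ((b - a) * (p i * \prod_(j | j != i) (1 - c * p j)))%:E.
Proof.
move=> a0 ab b1 c0 c1; rewrite Zind; last first.
  by move=> j; rewrite /box; case: ifP => _; exact: measurable_itv.
rewrite (bigD1 i) //= mulrA EFinM -prodEFin; congr (_ * _)%E.
  have /andP[p0 p1] := p01 i.
  rewrite /box eqxx (_ : _ @^-1` _ =
    [set w | Z i w < b * p i] `\` [set w | Z i w < a * p i]); last first.
    apply/seteqP; split=> w /=; rewrite in_itv /=.
      by case/andP => H ->; split=> //; apply/negP; rewrite -leNgt.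
    by case=> -> /negP; rewrite -leNgt => ->.
  rewrite probability_setD //; last first.
    by move=> w /= /lt_le_trans; apply; rewrite ler_pM2r.
  rewrite !Zunif -?EFinB ?mulrBl //; apply/andP; split; nra.
apply: eq_bigr => j ji; rewrite /box (negbTE ji).
have /andP[p0 p1] := p01 j.
rewrite (_ : _ @^-1` _ = ~` [set w | Z j w < c * p j]); last first.
  apply/seteqP; split=> w /=; rewrite in_itv /= andbT leNgt; by move/negP.
by rewrite probability_setC // Zunif -?EFinB //; apply/andP; split; nra.
Qed.

(** Cross-multiplied form of [Z i / p i < Z j / p j]. *)
Let win := [set w | forall j, j != i -> Z i w * p j < Z j w * p i].

Lemma measurable_uniform_race : measurable win.
Proof.
rewrite (_ : win = \bigcap_(j in [set j | j != i])
    [set w | Z i w * p j < Z j w * p i]); last first.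
  by apply/seteqP; split=> w.
apply: fin_bigcap_measurable => [|j _]; first exact: finite_finset.
have mlt : measurable_fun setT (fun w => Z i w * p j < Z j w * p i).
  by apply: measurable_fun_ltr; apply: measurable_funM.
by rewrite -[X in measurable X]setTI; exact: (mlt measurableT [set true]).
Qed.

(** With [F t] the probability that [i] wins and [Z i / p i < t], [eq_increment] compares [F] with
    [p i] times [prod_primitive p i]; the boxes supply the bounds on [F]. *)
Lemma uniform_race_prob : (exists j, p j = 1) -> (forall w, 0 <= Z i w) ->
  P win = (p i * (prod_primitive p i).[1])%:E.
Proof.
move=> [m pm] Z0.
have /andP[pi0 pi1] := p01 i.
have mwin := measurable_uniform_race.
pose early t := win `&` [set w | Z i w < t * p i].
have mearly t : measurable (early t) by exact: measurableI.
pose F t := fine (P (early t)).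
have PF t : P (early t) = (F t)%:E by rewrite fineK ?fin_num_measure.
have early0 : F 0 = 0.
  rewrite /F (_ : early 0 = set0) ?measure0 //.
  by apply/seteqP; split=> // w [_] /=; rewrite mul0r ltNge Z0.
(* A win with [Z i >= p i] forces [Z m >= 1], since [p m = 1], and this is a null event. *)
have win1 : P win = (F 1)%:E.
  have : P (win `\` early 1) = 0%E.
    apply: (@subset_measure0 _ _ _ P _ (~` [set w | Z m w < 1])).
    - exact: measurableD.
    - exact: measurableC.
    - move=> w [ww wlate]; apply/negP; rewrite -leNgt.
      have piZ : p i <= Z i w.
        rewrite leNgt; apply/negP => Zpi; apply: wlate.
        by split=> //=; rewrite mul1r.
      have [mi|/ww] := eqVneq m i; first by rewrite -pm mi.
      by rewrite pm mulr1 => /ltW/(le_trans piZ); rewrite ler_pMl.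
    - transitivity (1 - P [set w | (Z m w < 1)%R])%E.
        exact: probability_setC.
      by rewrite Zunif ?subee // ler01 lexx.
  rewrite probability_setD //; last by move=> w [].
  rewrite PF -[P win]fineK ?fin_num_measure // => -[/eqP].
  by rewrite subr_eq0 => /eqP ->.
rewrite win1; congr EFin.
have := @eq_increment R (fun t => p i * \prod_(j | j != i) (1 - t * p j)) F
  (fun t => p i * (prod_primitive p i).[t]).
rewrite early0 subr0 -mulrBr.
have -> : (prod_primitive p i).[0] = 0.
  rewrite horner_sum big1 // => J _.
  by rewrite hornerZ hornerXn expr0n mulr0.
rewrite subr0; apply=> a b a0 ab b1; last first.
  rewrite -mulrBr !(mulrCA _ (p i)) !ler_pM2l //.
  by apply: prod_primitive_increment => // j; have /andP[/ltW-> ->] := p01 j.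
have slab : early b `\` early a
    = win `&` [set w | a * p i <= Z i w < b * p i].
  apply/seteqP; split=> w /=.
    move=> [[ww wb] wa]; split=> //; rewrite wb andbT leNgt; apply/negP => H.
    exact: wa.
  by case=> ww /andP[aZ Zb]; split=> // -[_] /=; rewrite ltNge aZ.
have earlyab : early a `<=` early b.
  by move=> w [ww] /= wa; split=> //=; rewrite (lt_le_trans wa) // ler_pM2r.
have mslab : measurable (early b `\` early a) by exact: measurableD.
have Pslab : P (early b `\` early a) = (F b - F a)%:E.
  by rewrite probability_setD // !PF.
have mbox c : measurable (\bigcap_(j in [set: 'I_k]) (Z j @^-1` box a b c j)).
  apply: fin_bigcap_measurable => [|j _]; first exact: finite_finset.
  apply: mZpre.
  by rewrite /box; case: ifP => _; exact: measurable_itv.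
have a1 := le_trans ab b1; have b0 := le_trans a0 ab.
apply/andP; split; rewrite -lee_fin -Pslab -prob_box //.
  (* In the box with [c = b], [Z j / p j >= b > Z i / p i], so [i] wins. *)
  apply: le_measure; rewrite ?inE // slab => w wbox.
  have := wbox i I; rewrite /box /= eqxx /= in_itv /= => /andP[aZ Zb].
  split; last by rewrite /= aZ.
  move=> j ji; have := wbox j I; rewrite /box /= (negbTE ji) /= in_itv /= andbT.
  have /andP[pj0 _] := p01 j => bZ.
  apply: (@lt_le_trans _ _ (b * p i * p j)); first by rewrite ltr_pM2r.
  by rewrite mulrAC ler_pM2r.
(* Conversely, a win in the slab gives [Z j / p j > Z i / p i >= a]. *)
apply: le_measure; rewrite ?inE // slab => w [ww /= wab] j _.
rewrite /box /=; case: eqVneq => [->|ji] /=; rewrite in_itv //= andbT.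
have /andP[pj0 _] := p01 j; have /andP[aZ _] := wab.
rewrite -(ler_pM2r pi0); apply: le_trans (ltW (ww j ji)).
by rewrite mulrAC ler_pM2r.
Qed.

End uniform_race.

(** * Identification of the two output distributions *)

Theorem theorem1 (R : realType) (Data : Type) (nb : Data -> Data -> Prop)
  (k : nat) (q : Data -> 'I_k -> R) (D : Data) (Delta eps : R)
  (hDelta : 0 < Delta) (hsens : is_sensitivity nb q Delta) (heps : 0 < eps)
  (d : measure_display) (T : measurableType d) (P : probability T R)
  (X : 'I_k -> {RV P >-> R})
  (hlaw : forall i, has_expo_law P (eps / (2 * Delta)) (X i))
  (hind : mutually_independent P (fun i => (X i : T -> R))) :
  forall i : 'I_k,
    P (RNM_event (q D) (fun j => (X j : T -> R)) i) =
    (PF_prob eps Delta (q D) i)%:E.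
Proof.
move=> i; set qv := q D.
set rate := eps / (2 * Delta) in hlaw *.
have rate0 : 0 < rate by rewrite divr_gt0 // mulr_gt0.
pose p := pf_coin eps Delta qv i.
have qle j : qv j <= qmax qv i by exact: le_bigmax.
have p01 j : 0 < p j <= 1.
  by rewrite expR_gt0 -expR0 ler_expR mulr_ge0_le0 ?(ltW rate0) // subr_le0.
(* An index attaining the maximum has coin [1]. *)
have pE : exists j, p j = 1.
  have [m _ mmax] := arg_maxP qv (isT : xpredT i).
  exists m; rewrite /p /pf_coin (_ : qmax qv i = qv m) ?subrr ?mulr0 ?expR0 //.
  apply/le_anti; rewrite qle andbT.
  by apply: bigmax_le => [|j _]; exact: mmax.
pose h (x : R) := expR (- (rate * x)).
have mh : measurable_fun setT h.
  apply: measurableT_comp => //; apply: measurable_funN.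
  exact: measurable_funM.
pose Z j := h \o X j.
have mZ j : measurable_fun setT (Z j) by exact: measurableT_comp.
have Zind : mutually_independent P Z.
  move=> A mA; apply: (hind (fun j => h @^-1` A j)) => j.
  by rewrite -[X in measurable X]setTI; exact: mh.
have Zunif j z : 0 <= z <= 1 -> P [set w | Z j w < z] = z%:E.
  exact: expo_law_uniform.
have Z0 w : 0 <= Z i w by exact: expR_ge0.
have PFE : PF_prob eps Delta qv i = p i * (prod_primitive p i).[1].
  rewrite -sum_perm_prod_before mulr_sumr; apply: eq_bigr => s _.
  by rewrite mulrA mulrC.
rewrite PFE -(uniform_race_prob mZ Zind Zunif p01 pE Z0); congr (P _).
(* In [Z i * p j < Z j * p i] the maximum then cancels, leaving [qv j + X j < qv i + X i]. *)
have Zp j j' w : Z j w * p j'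
    = expR (- (rate * (X j w + (qmax qv i - qv j')))).
  by rewrite /Z /h /p /pf_coin -/rate /= -expRD; congr expR; ring.
apply: eq_set => w; apply: eq_forall => j; apply: eq_forall => ji.
rewrite !Zp ltr_expR ltrN2 ltr_pM2l //; congr is_true.
by apply/idP/idP => ?; lra.
Qed.
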